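(* Let $(\mathfrak g_0,B_0,(\rho,V))$ be a fundamental triplet over $\mathbb C$, and let $B$ be the extended invariant symmetric bilinear form on $\mathfrak g_{min}(\Gamma(\mathfrak g_0,B_0,\rho))$ described in the context. 1) If $\Gamma(\mathfrak g_0,B_0,\rho)$ is transitive, then $B$ is non-degenerate. 2) The form $B$ is also non-degenerate in the case where $\mathfrak g_0$ is reductive, the representation $V$ is completely reducible, and the restriction of $B_0$ to $Z(\mathfrak g_0)\cap\ker\rho$ is non-degenerate ($Z(\mathfrak g_0)$ denotes the center of $\mathfrak g_0$).
   Context: All vector spaces and Lie algebras are over $\mathbb C$. A quadratic Lie algebra is a pair $(\mathfrak g_0,B_0)$ where $\mathfrak g_0$ is a finite-dimensional Lie algebra and $B_0$ is a non-degenerate invariant symmetric bilinear form on $\mathfrak g_0$. A fundamental triplet $(\mathfrak g_0,B_0,(\rho,V))$ consists of a quadratic Lie algebra and a finite-dimensional representation $(\rho,V)$ of $\mathfrak g_0$; $(\rho^*,V^* )$ is the contragredient representation. A graded Lie algebra is a Lie algebra $\mathfrak g=\bigoplus_{i\in\mathbb Z}\mathfrak g_i$ with $\dim\mathfrak g_i<\infty$, $[\mathfrak g_i,\mathfrak g_j]\subset\mathfrak g_{i+j}$, generated by its local part $\mathfrak g_{-1}\oplus\mathfrak g_0\oplus\mathfrak g_1$. A local Lie algebra is a direct sum $\Gamma=\mathfrak g_{-1}\oplus\mathfrak g_0\oplus\mathfrak g_1$ of finite-dimensional spaces with bilinear anticommutative brackets $\mathfrak g_i\times\mathfrak g_j\to\mathfrak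 g_{i+j}$ for $i,j\in\{-1,0,1\}$ with $|i+j|\le1$, such that the Jacobi identity holds each time its three terms are defined. Morphisms are degree-preserving linear maps compatible with all (defined) brackets. By a theorem of Kac, for every local Lie algebra $\Gamma$ there is a unique graded Lie algebra $\mathfrak g_{max}(\Gamma)$ with local part $\Gamma$ such that every morphism of local Lie algebras from $\Gamma$ to the local part of a graded Lie algebra extends uniquely to a morphism of graded Lie algebras on $\mathfrak g_{max}(\Gamma)$. It has a unique maximal graded ideal $J_{max}$ with $J_{max}\cap\Gamma=\{0\}$, and $\mathfrak g_{min}(\Gamma):=\mathfrak g_{max}(\Gamma)/J_{max}$, with local part $\Gamma$. $\Gamma(\mathfrak g_0,B_0,\rho)=V^*\oplus\mathfrak g_0\oplus V$ (degrees $-1,0,1$) is the local Lie algebra with the bracket of $\mathfrak g_0$, $[U,X]=\rho(U)X$, $[U,Y]=\rho^*(U)Y$, and $[X,Y]\in\mathfrak g_0$ defined by $B_0([X,Y],U)=Y(\rho(U)X)$ for all $U\in\mathfrak g_0$ ($X\in V$, $Y\in V^*$). A local Lie algebra is transitive if: for $x\in\mathfrak g_i$ with $i\in\{0,1\}$, $[x,\mathfrak g_{-1}]=\{0\}$ implies $x=0$; and for $x\in\mathfrak g_i$ with $i\in\{-1,0\}$, $[x,\mathfrak g_1]=\{0\}$ implies $x=0$. The extended form $B$: on $\Gamma(\mathfrak g_0,B_0,\rho)$ let $B$ be the symmetric bilinear form with $B=B_0$ on $\mathfrak g_0\times\mathfrak g_0$, $B(X,Y)=B(Y,X)=Y(X)$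 for $X\in V$, $Y\in V^*$, and $B(\mathfrak g_i,\mathfrak g_j)=0$ for $i,j\in\{-1,0,1\}$ with $i+j\ne0$; it is invariant and non-degenerate. By a result of Kac it extends uniquely to an invariant symmetric bilinear form $B$ on $\mathfrak g_{min}(\Gamma(\mathfrak g_0,B_0,\rho))=\bigoplus_i\mathfrak g_i$ such that $B(\mathfrak g_i,\mathfrak g_j)=0$ whenever $i+j\ne0$. *)

(* Defs.v *)
From HB Require Import structures.
From mathcomp Require Import all_boot all_order all_algebra.
From mathcomp Require Import classical_sets reals.
From mathcomp Require Import complex.

Set Implicit Arguments.
Unset Strict Implicit.
Unset Printing Implicit Defensive.

Import GRing.Theory.
Local Open Scope classical_set_scope.
Local Open Scope ring_scope.

Section Forms.
Variable F : fieldType.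

Definition lie_bracket (L : lmodType F) (br : {bilinear L -> L -> L}) : Prop :=
  (forall x, br x x = 0) /\
  (forall x y z, br x (br y z) + br y (br z x) + br z (br x y) = 0).

Definition form_symmetric (L : lmodType F) (B : {biscalar L}) : Prop :=
  forall x y, B x y = B y x.

Definition form_invariant (L : lmodType F) (br : {bilinear L -> L -> L})
    (B : {biscalar L}) : Prop :=
  forall x y z, B (br x y) z = B x (br y z).

(* Non-degeneracy of the restriction of B to A; it is only used for symmetric
   forms, for which the left and right radicals coincide. *)
Definition form_nondegenerate_on (L : lmodType F) (A : set L) (B : {biscalar L}) :
    Prop :=
  forall x, A x -> (forall y, A y -> B x y = 0) -> x = 0.

Definition form_nondegenerate (L : lmodType F) (B : {biscalar L}) : Prop :=
  form_nondegenerate_on setT B.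

End Forms.

Section Representations.
Variable F : fieldType.

(* A representation is handled here through its action map; completely
   reducible means direct sum of irreducible subrepresentations. *)
Definition stable_subspace (T : Type) (V : vectType F) (act : T -> V -> V)
    (W : {vspace V}) : Prop :=
  forall t v, v \in W -> act t v \in W.

Definition irreducible_subspace (T : Type) (V : vectType F)
    (act : T -> V -> V) (W : {vspace V}) : Prop :=
  [/\ stable_subspace act W, W != 0%VS &
      forall W' : {vspace V}, stable_subspace act W' -> (W' <= W)%VS ->
        W' = 0%VS \/ W' = W].

Definition completely_reducible (T : Type) (V : vectType F)
    (act : T -> V -> V) : Prop :=
  exists (n : nat) (W : 'I_n -> {vspace V}),
    [/\ forall i, irreducible_subspace act (W i),
        (\sum_i W i)%VS = fullv & directv (\sum_i W i)].

(* A Lie algebra is reductive when its adjoint representation is completely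
   reducible. *)
Definition reductive (g : vectType F) (br : {bilinear g -> g -> g}) : Prop :=
  completely_reducible br.

Definition lie_center (g : lmodType F) (br : {bilinear g -> g -> g}) : set g :=
  [set x | forall y, br x y = 0].

End Representations.

Record quadratic_lie (F : fieldType) := QuadraticLie {
  ql_sort :> vectType F;
  ql_br : {bilinear ql_sort -> ql_sort -> ql_sort};
  ql_form : {biscalar ql_sort};
  ql_lie : lie_bracket ql_br;
  ql_sym : form_symmetric ql_form;
  ql_inv : form_invariant ql_br ql_form;
  ql_nondeg : form_nondegenerate ql_form }.

Definition is_representation (F : fieldType) (g : vectType F)
    (br : {bilinear g -> g -> g}) (V : vectType F)
    (rho : {linear g -> 'End(V)}) : Prop :=
  forall x y v, rho (br x y) v = rho x (rho y v) - rho y (rho x v).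

Record fundamental_triplet (F : fieldType) := FundamentalTriplet {
  ft_g0 : quadratic_lie F;
  ft_V : vectType F;
  ft_rho : {linear ft_g0 -> 'End(ft_V)};
  ft_rep : is_representation (ql_br ft_g0) ft_rho }.

Definition rep_ker (F : fieldType) (T : fundamental_triplet F) :
  set (ft_g0 T) := [set U | ft_rho T U = 0].

Arguments rep_ker {F} T _.

(* Only one bracket is recorded for each unordered pair of degrees, the other
   one being its opposite; the Jacobi identities are those for degrees
   (0,0,0), (0,0,1), (0,0,-1) and (0,1,-1), the only ones up to permutation
   whose three terms are all defined. *)
Record local_lie (F : fieldType) := LocalLie {
  ll_m1 : vectType F;
  ll_0 : vectType F;
  ll_1 : vectType F;
  br00 : {bilinear ll_0 -> ll_0 -> ll_0};
  br01 : {bilinear ll_0 -> ll_1 -> ll_1};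
  br0m : {bilinear ll_0 -> ll_m1 -> ll_m1};
  br1m : {bilinear ll_1 -> ll_m1 -> ll_0};
  br00_anti : forall u v, br00 u v = - br00 v u;
  jacobi000 : forall u v w,
    br00 u (br00 v w) + br00 v (br00 w u) + br00 w (br00 u v) = 0;
  jacobi001 : forall u v x,
    br01 u (br01 v x) - br01 v (br01 u x) - br01 (br00 u v) x = 0;
  jacobi00m : forall u v y,
    br0m u (br0m v y) - br0m v (br0m u y) - br0m (br00 u v) y = 0;
  jacobi01m : forall u x y,
    br00 u (br1m x y) - br1m x (br0m u y) - br1m (br01 u x) y = 0 }.

Arguments br00 {F l}.
Arguments br01 {F l}.
Arguments br0m {F l}.
Arguments br1m {F l}.

Definition transitive_local (F : fieldType) (G : local_lie F) : Prop :=
  [/\ forall u : ll_0 G, (forall y, br0m u y = 0) -> u = 0,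
      forall x : ll_1 G, (forall y, br1m x y = 0) -> x = 0,
      forall y : ll_m1 G, (forall x, br1m x y = 0) -> y = 0 &
      forall u : ll_0 G, (forall x, br01 u x = 0) -> u = 0].

Section GammaTriplet.
Variables (F : fieldType) (T : fundamental_triplet F).
Notation g0 := (ft_g0 T).
Notation V := (ft_V T).
Notation rho := (ft_rho T).
Notation B0 := (ql_form g0).

Definition dual : vectType F := 'Hom(V, F^o).

Definition rho_act (U : g0) (X : V) : V := rho U X.

Definition rho_dual (U : g0) (Y : dual) : dual := (- (Y \o rho U))%VF.

Definition flat_fun (U U' : g0) : F^o := B0 U U'.

Definition flat (U : g0) : 'Hom(g0, F^o) := linfun (flat_fun U).

Definition moment_fun (X : V) (Y : dual) (U : g0) : F^o := Y (rho U X).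

Definition moment (X : V) (Y : dual) : 'Hom(g0, F^o) :=
  linfun (moment_fun X Y).

(* The inverse of the isomorphism g0 -> g0^* given by B0 is applied to
   moment X Y; the resulting characterization is Gamma_bracketP. *)
Definition Gamma_bracket (X : V) (Y : dual) : g0 :=
  (linfun flat)^-1%VF (moment X Y).

Lemma rho_act_bilinear : bilinear_for *:%R *:%R rho_act.
Proof.
split=> [X|U] a x y; rewrite /rho_act ?linearP //.
by rewrite !lfunE /= lfunE.
Qed.

HB.instance Definition _ := bilinear_isBilinear.Build F g0 V V *:%R *:%R
  rho_act rho_act_bilinear.

Lemma rho_dual_bilinear : bilinear_for *:%R *:%R rho_dual.
Proof.
split=> [Y|U] a x y; apply/lfunP => v;
  rewrite /rho_dual !(opp_lfunE, add_lfunE, scale_lfunE, comp_lfunE) /=.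
  rewrite linearP !(add_lfunE, scale_lfunE) linearP.
  by rewrite opprD scalerN.
by rewrite opprD scalerN.
Qed.

HB.instance Definition _ := bilinear_isBilinear.Build F g0 dual dual *:%R *:%R
  rho_dual rho_dual_bilinear.

Let flat_fun_linear U : linear (flat_fun U).
Proof. by move=> a x y; rewrite /flat_fun linearDr linearZr. Qed.
HB.instance Definition _ U := GRing.isLinear.Build F g0 F^o *:%R
  (flat_fun U) (flat_fun_linear U).

Lemma flatE U U' : flat U U' = B0 U U'.
Proof. by rewrite /flat lfunE. Qed.

Let flat_linear : linear flat.
Proof.
move=> a x y; apply/lfunP => v.
by rewrite add_lfunE scale_lfunE !flatE linearDl linearZl.
Qed.
HB.instance Definition _ := GRing.isLinear.Build F g0 'Hom(g0, F^o) *:%R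
  flat flat_linear.

Let moment_fun_linear X Y : linear (moment_fun X Y).
Proof.
by move=> a x y; rewrite /moment_fun linearP add_lfunE scale_lfunE linearP.
Qed.
HB.instance Definition _ X Y := GRing.isLinear.Build F g0 F^o *:%R
  (moment_fun X Y) (moment_fun_linear X Y).

Lemma momentE X Y U : moment X Y U = Y (rho U X).
Proof. by rewrite /moment lfunE. Qed.

Lemma flat_surj f : linfun flat ((linfun flat)^-1%VF f) = f.
Proof.
have ker0 : lker (linfun flat) == 0%VS.
  apply/lker0P => x y; rewrite !lfunE => /lfunP exy.
  apply/eqP; rewrite -subr_eq0; apply/eqP.
  apply: (@ql_nondeg _ g0) => // z _.
  by rewrite linearBl /= -!flatE exy subrr.
have limgT : limg (linfun flat) = fullv.
  apply/eqP; rewrite eqEdim subvf /=.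
  have := limg_ker_dim (linfun flat) fullv.
  rewrite (eqP ker0) capv0 dimv0 add0n => ->.
  by rewrite !dimvf /dim /= muln1.
have : f \in limg (linfun flat) by rewrite limgT memvf.
exact: limg_lfunVK.
Qed.

Lemma Gamma_bracketP X Y U : B0 (Gamma_bracket X Y) U = Y (rho U X).
Proof.
by rewrite -flatE -momentE -[moment X Y]flat_surj [in RHS]lfunE.
Qed.

Let B0_inj x y : (forall z, B0 x z = B0 y z) -> x = y.
Proof.
move=> exy; apply/eqP; rewrite -subr_eq0; apply/eqP.
by apply: (@ql_nondeg _ g0) => // z _; rewrite linearBl /= exy subrr.
Qed.

Lemma Gamma_bracket_bilinear : bilinear_for *:%R *:%R Gamma_bracket.
Proof.
split=> [Y|X] a x y; apply: B0_inj => z;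
  rewrite linearDl linearZl /= !Gamma_bracketP.
  by rewrite !linearP.
by rewrite add_lfunE scale_lfunE.
Qed.

HB.instance Definition _ := bilinear_isBilinear.Build F V dual g0 *:%R *:%R
  Gamma_bracket Gamma_bracket_bilinear.

Lemma ql_anti (x y : g0) : ql_br g0 x y = - ql_br g0 y x.
Proof.
have [alt _] := ql_lie g0; apply/eqP; rewrite -addr_eq0.
have := alt (x + y); rewrite linearDl !linearDr /= !alt add0r addr0.
by move=> ->.
Qed.

Let jacobi_rho u v X :
  rho_act u (rho_act v X) - rho_act v (rho_act u X)
    - rho_act (ql_br g0 u v) X = 0.
Proof.
by rewrite /rho_act ft_rep subrr.
Qed.

Let jacobi_rho_dual u v Y :
  rho_dual u (rho_dual v Y) - rho_dual v (rho_dual u Y)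
    - rho_dual (ql_br g0 u v) Y = 0.
Proof.
apply/lfunP => x; rewrite /rho_dual.
rewrite !(opp_lfunE, add_lfunE, comp_lfunE) /= zero_lfunE ft_rep linearB /=.
by rewrite !opprK addrA addrNK subrr.
Qed.

Let jacobi_bracket u X Y :
  ql_br g0 u (Gamma_bracket X Y) - Gamma_bracket X (rho_dual u Y)
    - Gamma_bracket (rho_act u X) Y = 0.
Proof.
apply: B0_inj => z; rewrite !linearBl /= linear0l !Gamma_bracketP.
rewrite ql_anti linearNl /= (ql_inv (_ : g0)) Gamma_bracketP ft_rep.
rewrite /rho_dual /rho_act !(opp_lfunE, add_lfunE, comp_lfunE) /= linearB /=.
by rewrite opprB opprK addrNK subrr.
Qed.

Definition Gamma : local_lie F :=
  @LocalLie F dual g0 V (ql_br g0) rho_act rho_dual Gamma_bracket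
    ql_anti (proj2 (ql_lie g0)) jacobi_rho jacobi_rho_dual jacobi_bracket.

(* An element (Y, U, X) stands for Y + U + X in V^* + g0 + V. *)
Definition Gamma_form (a b : dual * g0 * V) : F :=
  B0 a.1.2 b.1.2 + b.1.1 a.2 + a.1.1 b.2.

End GammaTriplet.

(* A grading is given by the family of homogeneous components, subsets of the
   (possibly infinite-dimensional) underlying space; gl_span and gl_direct say
   that the space is their direct sum. *)
Record graded_lie (F : fieldType) := GradedLie {
  gl_sort :> lmodType F;
  gl_br : {bilinear gl_sort -> gl_sort -> gl_sort};
  gl_deg : int -> set gl_sort;
  gl_lie : lie_bracket gl_br;
  gl_submod : forall i, submod_closed (mem (gl_deg i));
  gl_findim : forall i, exists (n : nat) (b : 'I_n -> gl_sort),
    forall x, gl_deg i x -> exists c : 'I_n -> F, x = \sum_k c k *: b k;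
  gl_span : forall x, exists (s : seq int) (c : int -> gl_sort),
    (forall i, gl_deg i (c i)) /\ x = \sum_(i <- s) c i;
  gl_direct : forall (s : seq int) (c : int -> gl_sort), uniq s ->
    (forall i, gl_deg i (c i)) -> \sum_(i <- s) c i = 0 ->
    forall i, i \in s -> c i = 0;
  gl_brdeg : forall i j x y, gl_deg i x -> gl_deg j y ->
    gl_deg (i + j) (gl_br x y);
  gl_gen : forall S : set gl_sort, submod_closed (mem S) ->
    (forall x y, S x -> S y -> S (gl_br x y)) ->
    gl_deg (-1) `<=` S -> gl_deg 0 `<=` S -> gl_deg 1 `<=` S -> S = setT }.

Arguments gl_br {F} g : rename.
Arguments gl_deg {F} g i : rename.

Section Graded.
Variable F : fieldType.
Implicit Types (G : local_lie F) (g h : graded_lie F).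

Definition local_part g : set g :=
  [set x | exists a b c, [/\ gl_deg g (-1) a, gl_deg g 0 b, gl_deg g 1 c
                          & x = a + b + c]].

Arguments local_part : clear implicits.

Definition graded_ideal g (J : set g) : Prop :=
  [/\ submod_closed (mem J),
      forall x y, J y -> J (gl_br g x y) &
      forall x, J x -> exists (s : seq int) (c : int -> g),
        (forall i, gl_deg g i (c i) /\ J (c i)) /\ x = \sum_(i <- s) c i].

Definition graded_hom g h (f : {linear g -> h}) : Prop :=
  (forall x y, f (gl_br g x y) = gl_br h (f x) (f y)) /\
  (forall i x, gl_deg g i x -> gl_deg h i (f x)).

(* A morphism of local Lie algebras from G to the local part of g. *)
Record local_hom G g := LocalHom {
  lh_m1 : {linear ll_m1 G -> g};
  lh_0 : {linear ll_0 G -> g};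
  lh_1 : {linear ll_1 G -> g};
  lh_deg_m1 : forall y, gl_deg g (-1) (lh_m1 y);
  lh_deg_0 : forall u, gl_deg g 0 (lh_0 u);
  lh_deg_1 : forall x, gl_deg g 1 (lh_1 x);
  lh_br00 : forall u v, lh_0 (br00 u v) = gl_br g (lh_0 u) (lh_0 v);
  lh_br01 : forall u x, lh_1 (br01 u x) = gl_br g (lh_0 u) (lh_1 x);
  lh_br0m : forall u y, lh_m1 (br0m u y) = gl_br g (lh_0 u) (lh_m1 y);
  lh_br1m : forall x y, lh_0 (br1m x y) = gl_br g (lh_1 x) (lh_m1 y) }.

(* phi identifies G with the local part of g. *)
Definition local_iso G g (phi : local_hom G g) : Prop :=
  [/\ injective (lh_m1 phi), injective (lh_0 phi) & injective (lh_1 phi)] /\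
  [/\ range (lh_m1 phi) = gl_deg g (-1), range (lh_0 phi) = gl_deg g 0 &
      range (lh_1 phi) = gl_deg g 1].

Definition local_factor G g h (f : g -> h) (phi : local_hom G g)
    (psi : local_hom G h) : Prop :=
  [/\ forall y, f (lh_m1 phi y) = lh_m1 psi y,
      forall u, f (lh_0 phi u) = lh_0 psi u &
      forall x, f (lh_1 phi x) = lh_1 psi x].

(* The graded Lie algebras g_max(G) and g_min(G) are determined up to unique
   isomorphism; is_gmax phi and is_gmin phi say that phi exhibits g as such an
   algebra, with its local part identified with G. *)
Definition is_gmax G g (phi : local_hom G g) : Prop :=
  local_iso phi /\
  forall h (psi : local_hom G h),
    exists f : {linear g -> h},
      [/\ graded_hom f, local_factor f phi psi &
          forall f' : {linear g -> h}, graded_hom f' ->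
            local_factor f' phi psi -> f' =1 f].

Definition is_Jmax g (J : set g) : Prop :=
  [/\ graded_ideal J, J `&` local_part g = [set 0] &
      forall J' : set g, graded_ideal J' -> J' `&` local_part g = [set 0] ->
        J `<=` J' -> J' = J].

(* g is the quotient of g_max(G) by J_max, presented by its projection p. *)
Definition is_gmin G g (phi : local_hom G g) : Prop :=
  exists (gmax : graded_lie F) (phimax : local_hom G gmax) (J : set gmax)
         (p : {linear gmax -> g}),
    [/\ is_gmax phimax, is_Jmax J, graded_hom p,
        range p = setT /\ [set x | p x = 0] = J & local_factor p phimax phi].

End Graded.

Arguments local_part {F} g _.

Definition extended_form (F : fieldType) (T : fundamental_triplet F)
    (g : graded_lie F) (phi : local_hom (Gamma T) g) (B : {biscalar g}) : Prop :=
  [/\ form_symmetric B, form_invariant (gl_br g) B,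
      forall (i j : int) x y, i + j != 0 -> gl_deg g i x -> gl_deg g j y ->
        B x y = 0 &
      forall a b : dual T * ft_g0 T * ft_V T,
        B (lh_m1 phi a.1.1 + lh_0 phi a.1.2 + lh_1 phi a.2)
          (lh_m1 phi b.1.1 + lh_0 phi b.1.2 + lh_1 phi b.2) = Gamma_form a b].

(* Main.v *)
Require Import Defs.
From mathcomp Require Import all_boot all_order all_algebra.
From mathcomp Require Import classical_sets reals.
From mathcomp Require Import complex.
Import GRing.Theory.
Local Open Scope classical_set_scope.
Local Open Scope ring_scope.

(** The radical of an invariant form for which components of non-opposite
    degrees are orthogonal is a graded ideal ([pullback_radical_graded_ideal]).
    The extended form is non-degenerate on the local part, simply because [B0]
    and the pairing of [V] with its dual are ([Gamma_form_nondegenerate]), so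
    the radical meets the local part in zero.  But the minimal graded Lie
    algebra is the quotient of the maximal one by a graded ideal that is
    maximal among those meeting the local part in zero: the preimage of the
    radical in the maximal algebra is such an ideal and contains the one
    divided out, hence equals it, and the radical vanishes
    ([extended_form_nondegenerate]). *)

(** A decomposition may repeat a degree; grouping equal degrees gives genuine
    homogeneous components, indexed by all the integers. *)
Lemma homogeneous_decomposition (F : fieldType) (g : graded_lie F) (x : g) :
  exists (s : seq int) (c : int -> g),
    [/\ uniq s, forall i, gl_deg g i (c i), forall i, i \notin s -> c i = 0
      & x = \sum_(i <- s) c i].
Proof.
have [s [c [cdeg ->]]] := gl_span x.
exists (undup s), (fun i => c i *+ count_mem i s); split.
- exact: undup_uniq.
- move=> i; have [d0 dZ] := gl_submod g i.
  elim: (count_mem i s) => [|n IHn]; first by rewrite mulr0n; apply/set_mem.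
  rewrite mulrS -[X in X + _]scale1r; apply/set_mem.
  by apply: dZ; apply/mem_set.
- by move=> i; rewrite mem_undup => /count_memPn ->; rewrite mulr0n.
- by rewrite -[LHS]big_undup_iterop_count.
Qed.

(** Working with the radical of the form pulled back along [p], rather than
    with the preimage of the radical, avoids having to compare decompositions
    in the source and in the target. *)
Definition pullback_radical {F : fieldType} {g h : graded_lie F}
    (p : g -> h) (B : {biscalar h}) : set g :=
  [set x | forall y, B (p x) (p y) = 0].

(** Pairing [x] with an element of degree [- i] only sees the component of
    degree [i], so each component of an element of the radical is in the
    radical. *)
Lemma pullback_radical_graded_ideal (F : fieldType) (g h : graded_lie F)
    (p : {linear g -> h}) (B : {biscalar h}) :
  graded_hom p -> form_invariant (gl_br h) B ->
  (forall (i j : int) x y, i + j != 0 -> gl_deg h i x -> gl_deg h j y ->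
     B x y = 0) ->
  graded_ideal (pullback_radical p B).
Proof.
move=> [p_br p_deg] B_inv B_orth; split.
- split=> [|a u v /set_mem u_rad /set_mem v_rad]; apply/mem_set => y.
    by rewrite linear0 linear0l.
  by rewrite linearP linearPl /= u_rad v_rad mulr0 addr0.
- move=> x y y_rad z.
  have br_anti (u v : h) : gl_br h u v = - gl_br h v u.
    have [alt _] := gl_lie h; apply/eqP; rewrite -addr_eq0.
    have := alt (u + v); rewrite linearDl !linearDr /= !alt add0r addr0.
    by move=> ->.
  by rewrite p_br br_anti linearNl /= B_inv -p_br y_rad oppr0.
- move=> x x_rad.
  have [s [c [s_uniq c_deg c0 x_sum]]] := homogeneous_decomposition _ g x.
  exists s, c; split=> // i; split=> // y.
  have [i_s|/c0->] := boolP (i \in s); last by rewrite linear0 linear0l.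
  have [t [d [d_deg ->]]] := gl_span y.
  rewrite !linear_sum big1 // => j _.
  have [ij|ij] := eqVneq (i + j) 0; last first.
    by apply: (B_orth i j) => //; apply: p_deg.
  have := x_rad (d j).
  rewrite x_sum linear_sum /= linear_sumlz (bigD1_seq i) //= big1 ?addr0 //.
  move=> k ki; apply: (B_orth k j); try exact: p_deg.
  by apply: contra ki => /eqP kj; apply/eqP/(addIr j); rewrite kj ij.
Qed.

Lemma dual_separates (F : fieldType) (V : vectType F) (x : V) :
  (forall f : 'Hom(V, F^o), f x = 0) -> x = 0.
Proof.
move=> x0; rewrite (coord_vbasis (memvf x)) big1 // => i _.
have := x0 (linfun (coord (vbasis fullv) i : V -> F^o)).
by rewrite lfunE /= => ->; rewrite scale0r.
Qed.

Lemma Gamma_form_nondegenerate (F : fieldType) (T : fundamental_triplet F)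
    (a : dual T * ft_g0 T * ft_V T) :
  (forall b, Gamma_form a b = 0) -> a = 0.
Proof.
case: a => [[Y U] X] a0.
have -> : U = 0.
  apply: (@ql_nondeg _ (ft_g0 T)) => // U' _; have := a0 (0, U', 0).
  by rewrite /Gamma_form /= linear0 zero_lfunE !addr0.
have -> : X = 0.
  apply: dual_separates => f; have := a0 (f, 0, 0).
  by rewrite /Gamma_form /= !linear0 add0r addr0.
have -> // : Y = 0.
apply/lfunP => X'; have := a0 (0, 0, X').
by rewrite /Gamma_form /= !linear0 !zero_lfunE !add0r.
Qed.

(** The preimage of the radical of [B] in the maximal algebra is compared with
    the maximal ideal; the form itself shows that its intersection with the
    local part is zero, as [phi] carries [B] to [Gamma_form]. *)
Lemma extended_form_nondegenerate (F : fieldType) (T : fundamental_triplet F)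
    (g : graded_lie F) (phi : local_hom (Gamma T) g) (B : {biscalar g}) :
  is_gmin phi -> extended_form phi B -> form_nondegenerate B.
Proof.
move=> [gmax [phimax [J [p [[phimax_iso _] Jmax p_hom [p_surj p_ker] p_phi]]]]].
move=> [_ B_inv B_orth B_Gamma].
have [J_ideal J_local J_max] := Jmax.
have rad_ideal : graded_ideal (pullback_radical p B).
  exact: pullback_radical_graded_ideal.
have rad_local : pullback_radical p B `&` local_part gmax = [set 0].
  apply/seteqP; split=> [x [x_rad] | x ->]; last first.
    have [_ zero_local] : (J `&` local_part gmax) 0 by rewrite J_local.
    by split=> // z; rewrite linear0 linear0l.
  have [_ [range_m1 range_0 range_1]] := phimax_iso.
  move=> [y [u [v []]]]; rewrite -range_m1 -range_0 -range_1.
  move=> [Y _ <-] [U _ <-] [X _ <-] x_sum.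
  have [pm1 p0 p1] := p_phi; rewrite x_sum.
  have [-> -> ->] : (Y, U, X) = 0 :> dual T * ft_g0 T * ft_V T.
    apply: Gamma_form_nondegenerate => b; rewrite -B_Gamma /=.
    have := x_rad (lh_m1 phimax b.1.1 + lh_0 phimax b.1.2 + lh_1 phimax b.2).
    by rewrite x_sum !linearD /= !pm1 !p0 !p1.
  by rewrite !linear0 !addr0.
have J_rad : J `<=` pullback_radical p B.
  by move=> x; rewrite -p_ker => px0 y; rewrite px0 linear0l.
have rad_J := J_max _ rad_ideal rad_local J_rad.
move=> x _ x_rad.
have [z _ zx] : range p x by rewrite p_surj.
have : J z by rewrite -rad_J => y; rewrite zx; apply: x_rad.
by rewrite -p_ker /= zx.
Qed.

Theorem proposition3p5p2 (R : realType) (T : fundamental_triplet R[i])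
    (gmin : graded_lie R[i]) (phi : local_hom (Gamma T) gmin)
    (B : {biscalar gmin}) :
  is_gmin phi -> extended_form phi B ->
  (transitive_local (Gamma T) -> form_nondegenerate B) /\
  (reductive (ql_br (ft_g0 T)) ->
   completely_reducible (fun U : ft_g0 T => ft_rho T U : ft_V T -> ft_V T) ->
   form_nondegenerate_on (lie_center (ql_br (ft_g0 T)) `&` rep_ker T)
     (ql_form (ft_g0 T)) ->
   form_nondegenerate B).
Proof.
by move=> phi_gmin B_ext; split=> *; apply: extended_form_nondegenerate phi_gmin _.
Qed.
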